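(* Let $n\ge 1$ be an integer, let $A$ be a complex number which is not a negative integer, and let $B_1,\dots,B_n$ be pairwise distinct complex numbers such that $\binom{A+n-1}{B_i-1}\neq 0$ for every $i$. Let $M$ be the $n\times n$ matrix \[ M=\left[\binom{A}{B_j-i}\right]_{i,j=1}^{n}. \] Then $M$ is invertible and, for all $1\le i,j\le n$, \[ [M^{-1}]_{i,j}=\binom{A+n-1}{B_i-1}^{-1}\sum_{k=1}^{j}\binom{A+n-1}{k-1}\binom{A-1+j-k}{j-k}(-1)^{k+j}\prod_{l=1,\,l\neq i}^{n}\frac{k-B_l}{B_i-B_l}. \]
   Context: Binomial coefficients with complex upper index $x$ are interpreted as follows: if $y$ is an integer, $\binom{x}{y}=\frac{x(x-1)\cdots(x-y+1)}{y!}$ for $y\ge 0$ and $\binom{x}{y}=0$ for $y<0$; if $y$ is not an integer (and $x$ is not a negative integer), $\binom{x}{y}=\frac{\Gamma(x+1)}{\Gamma(y+1)\Gamma(x-y+1)}$. In particular, when $A$ and all $B_j$ are integers these are the usual binomial coefficients. *)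

(* Defs.v *)
From mathcomp Require Import all_boot all_order all_algebra.
From mathcomp Require Import all_classical all_reals all_analysis.
From mathcomp Require Export complex.
Set Implicit Arguments.
Unset Strict Implicit.
Unset Printing Implicit Defensive.
Import Order.TTheory GRing.Theory Num.Theory.
Import numFieldNormedType.Exports.
Local Open Scope classical_set_scope.
Local Open Scope ring_scope.
Local Open Scope complex_scope.

(* n ^ z = exp (z ln n), for n > 0. *)
Definition natpowC (R : realType) (n : nat) (z : R[i]) : R[i] :=
  (expR (complex.Re z * ln n%:R))%:C *
  (cos (complex.Im z * ln n%:R) +i* sin (complex.Im z * ln n%:R)).

(* Euler's definition of the Gamma function,
   Gamma z = lim_n n! n^z / (z (z + 1) ... (z + n)).
   At a pole z = - m the denominators vanish for n >= m, so with the convention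
   x / 0 = 0 the sequence is eventually 0 and (Gamma z)^-1 = 0, which is the
   value at z of the entire function 1 / Gamma. *)
Definition Gamma (R : realType) (z : R[i]) : R[i] :=
  lim ((fun n : nat =>
    n`!%:R * natpowC n z / \prod_(k < n.+1) (z + k%:R) : R[i]^o) @ \oo).

(* y is an integer if and only if it is equal to the floor of its real part.
   For y not an integer, x is meant not to be a negative integer; when x - y is
   a negative integer, 1 / Gamma (x - y + 1) = 0 and the coefficient is 0. *)
Definition binomC (R : realType) (x y : R[i]) : R[i] :=
  let m := Num.floor (complex.Re y) in
  if y == m%:~R then
    match m with
    | Posz p => (\prod_(k < p) (x - k%:R)) / p`!%:R
    | Negz _ => 0
    end
  else Gamma (x + 1) / (Gamma (y + 1) * Gamma (x - y + 1)).

(* Main.v *)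
(** The relation [(Gamma z)^-1 = z / Gamma (z + 1)] gives two contiguity relations
    for the binomial coefficient, and by iterating them
    [binom(A, y - i) = binom(A+n-1, y - 1) * q_i(y) / P] with
    [P = (A + 1) ... (A + n - 1) <> 0] and
    [q_i(y) = (y-1) ... (y-i+1) (A+n-y) ... (A+i+1-y)], a polynomial of degree [n - 1].
    So column [j] of [M] lists the values [q_i(B_j)] up to the nonzero factor
    [binom(A+n-1, B_j - 1) / P].  In [M * N], where [N] is the claimed inverse, the
    sum over the nodes [B_l] is Lagrange interpolation of [q_i] at the integer [k];
    applying the relation again with [y = k], the [(i, j)] entry becomes the
    Vandermonde convolution [sum_k binom(A, k-i) binom(-A, j-k)], which is [delta_ij]. *)
Require Import Defs.
From mathcomp Require Import all_boot all_order all_algebra.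
From mathcomp Require Import all_classical all_reals all_analysis.
From mathcomp Require Import ring.
Import Order.TTheory GRing.Theory Num.Theory.
Import numFieldNormedType.Exports.
Local Open Scope classical_set_scope.
Local Open Scope ring_scope.

Set Implicit Arguments.
Unset Strict Implicit.

(** * Euler's limit and the functional equation of Gamma *)

Lemma cvg_natrV_complex (R : realType) : (n%:R^-1 : R[i]^o) @[n --> \oo] --> (0 : R[i]^o).
Proof.
apply/cvgrPdist_le => e e0.
(* A positive element of [R[i]] is real, so the estimate takes place in [R]. *)
have eE : e = (complex.Re e)%:C%C by rewrite RRe_real // gtr0_real.
have re0 : 0 < complex.Re e by move: e0; rewrite ltcE => /andP[].
near=> n.
have n0 : (0 < n)%N by near: n; exists 1%N.
rewrite sub0r normrN normfV normr_nat eE.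
rewrite -(rmorph_nat (real_complex R)) -fmorphV lecR.
rewrite -[leRHS]invrK lef_pV2 ?posrE ?ltr0n ?invr_gt0 //.
near: n; exact: nbhs_infty_ger.
Unshelve. all: by end_near. Qed.

Lemma numField_hausdorff (K : numFieldType) : hausdorff_space K.
Proof. exact: norm_hausdorff. Qed.

(* No convergence of [u] is assumed: a divergent sequence has the junk limit
   [point = 0]. Thus the functional equation of [Gamma] needs no proof that
   Euler's limit exists. *)
Lemma limM_nonzero (K : numFieldType) (u c v : nat -> K) (c0 : K) :
    c0 != 0 -> c @ \oo --> c0 ->
    (\forall n \near \oo, v n = c n * u n) ->
  lim (v @ \oo) = c0 * lim (u @ \oo).
Proof.
move=> c0N0 cc vE.
have [cu|dvu] := pselect (cvg (u @ \oo)).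
  apply: (cvg_lim (@numField_hausdorff K)).
  apply: cvg_trans (near_eq_cvg _) (cvgM cc cu).
  by near=> n; rewrite (near vE n).
rewrite (dvgP dvu) -[point]/(0 : K) mulr0; apply: dvgP => cv; apply: dvu.
have cN0 : \forall n \near \oo, c n != 0 by exact: cvgr_neq0 cc c0N0.
apply: (cvgP (c0^-1 * lim (v @ \oo))).
apply: cvg_trans (near_eq_cvg _) (cvgM (cvgV c0N0 cc) cv).
by near=> n; rewrite /= (near vE n) ?mulKf ?(near cN0 n).
Unshelve. all: by end_near. Qed.

Lemma cvg_add_mul_natrV (K : numFieldType) (a b : K) :
  (n%:R^-1 : K) @[n --> \oo] --> (0 : K) ->
  (a + b * n%:R^-1) @[n --> \oo] --> a.
Proof.
move=> cV; rewrite -[X in _ --> X]addr0 -[X in _ --> _ + X](mulr0 b).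
by apply: cvgD; [exact: cvg_cst|apply: cvgM; [exact: cvg_cst|]].
Qed.

Lemma natpowCD1 (R : realType) (n : nat) (z : R[i]) : (0 < n)%N ->
  natpowC n (z + 1) = n%:R * natpowC n z.
Proof.
move=> n0; case: z => a b; rewrite /natpowC /= addr0 mulrDl mul1r expRD lnK ?posrE ?ltr0n //.
by rewrite rmorphM rmorph_nat; ring.
Qed.

(** The factor [k = 0] makes every denominator vanish, so each term of Euler's sequence is 0 by the
    convention [x / 0 = 0]. *)
Lemma Gamma0 (R : realType) : Gamma (0 : R[i]) = 0.
Proof.
rewrite /Gamma (_ : (fun n => _) = fun=> 0); last first.
  by apply: funext => n; rewrite big_ord_recl add0r mul0r invr0 mulr0.
exact: (lim_cst (@numField_hausdorff (R[i] : numFieldType))).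
Qed.

(** The [n]-th Euler quotient at [z] is the one at [z + 1] times [c n = (z + 1 + n) / (z n)], and
    [c n] tends to [z^-1], which is nonzero. *)
Lemma GammaD1 (R : realType) (z : R[i]) : z != 0 -> Gamma (z + 1) = z * Gamma z.
Proof.
move=> z0; apply: (mulIf (invr_neq0 z0)); rewrite mulrAC mulfV // mul1r mulrC; apply: esym.
pose K : numFieldType := R[i].
pose c n : K := z^-1 + z^-1 * (z + 1) * n%:R^-1.
have cc : c @ \oo --> (z^-1 : K) by apply: cvg_add_mul_natrV; exact: cvg_natrV_complex.
have cN0 : \forall n \near \oo, c n != 0 by exact: cvgr_neq0 cc (invr_neq0 z0).
apply: (@limM_nonzero K _ c); [exact: invr_neq0|exact: cc|].
near=> n.
have n0 : (0 < n)%N by near: n; exists 1%N.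
have nN0 : n%:R != 0 :> R[i] by rewrite pnatr_eq0 -lt0n.
have cE : c n = z^-1 * (z + 1 + n%:R) * n%:R^-1 by rewrite /c; field; rewrite nN0 z0.
(* This yields [z + 1 + n != 0], by which the product is divided below; it could fail for small [n]
   when [z] is a negative integer. *)
have : c n != 0 by near: n.
rewrite cE natpowCD1 // !mulf_eq0 !negb_or => /andP[/andP[_ zn] _].
have -> : \prod_(k < n.+1) (z + k%:R) =
    (z * \prod_(k < n.+1) (z + 1 + k%:R)) / (z + 1 + n%:R).
  rewrite [in LHS]big_ord_recl [in RHS]big_ord_recr /= addr0.
  rewrite mulrA mulfK //; congr (_ * _).
  by apply: eq_bigr => i _; rewrite -addrA -natr1 (addrC 1).
rewrite !invfM invrK; move: (\prod_(_ < _) _)^-1 => P.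
by field; rewrite z0 nN0.
Unshelve. all: by end_near. Qed.

(* Unlike [GammaD1], this also holds at the pole [z = 0], because [Gamma 0 = 0]
   and [0^-1 = 0]. *)
Lemma invr_GammaD1 (R : realType) (z : R[i]) : (Gamma z)^-1 = z * (Gamma (z + 1))^-1.
Proof.
have [->|z0] := eqVneq z 0; first by rewrite Gamma0 invr0 mul0r.
by rewrite GammaD1 // invfM mulVKf.
Qed.

(** * Contiguity relations for the binomial coefficient *)

Lemma binomC_int (R : realType) (x : R[i]) (m : int) :
  binomC x m%:~R = match m with
    | Posz p => (\prod_(k < p) (x - k%:R)) / p`!%:R
    | Negz _ => 0
    end.
Proof.
rewrite /binomC; have -> : complex.Re (m%:~R : R[i]) = m%:~R.
  by rewrite -(rmorph_int (real_complex R)).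
by rewrite intrKfloor eqxx.
Qed.

Lemma binomC_nat (R : realType) (x : R[i]) (p : nat) :
  binomC x p%:R = (\prod_(k < p) (x - k%:R)) / p`!%:R.
Proof. by rewrite pmulrn binomC_int. Qed.

Lemma binomC_nonint (R : realType) (x y : R[i]) : (forall m : int, y <> m%:~R) ->
  binomC x y = Gamma (x + 1) / (Gamma (y + 1) * Gamma (x - y + 1)).
Proof. by move=> yN; rewrite /binomC ifF //; apply/eqP/yN. Qed.

Lemma binomC_upper (R : realType) (a y : R[i]) : a + 1 != 0 ->
  binomC a y * (a + 1) = binomC (a + 1) y * (a + 1 - y).
Proof.
move=> a0; have [[m ->]|yN] := pselect (exists m : int, y = m%:~R).
  rewrite !binomC_int; case: m => [p|p]; last by rewrite !mul0r.
  rewrite mulrAC [RHS]mulrAC; congr (_ / _); rewrite -pmulrn.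
  (* Both numerators are [(a + 1) a ... (a + 1 - p)], with the first or the last factor split
     off. *)
  transitivity (\prod_(k < p.+1) (a + 1 - k%:R)); last by rewrite big_ord_recr.
  rewrite big_ord_recl subr0 mulrC; congr (_ * _).
  by apply: eq_bigr => i _; rewrite /= /bump /= natrD; ring.
have yN' m : y <> m%:~R by move=> ym; apply: yN; exists m.
(* [a - y + 1] may be a pole of Gamma, hence the relation for the reciprocal at this argument. *)
rewrite !binomC_nonint // (GammaD1 a0) !invfM (invr_GammaD1 (a - y + 1)).
by rewrite (_ : a + 1 - y = a - y + 1); ring.
Qed.

(** Passing from [(a, y - 1)] to [(a + 1, y)] keeps the difference of the two indices, so only two
    of the three Gamma factors change. *)
Lemma binomC_diag (R : realType) (a y : R[i]) : a + 1 != 0 ->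
  binomC a (y - 1) * (a + 1) = binomC (a + 1) y * y.
Proof.
move=> a0; have [[m ->]|yN] := pselect (exists m : int, y = m%:~R).
  rewrite -[1 in y in binomC a y]/(1%:~R) -rmorphB /= !binomC_int.
  case: m => [[|p]|p] /=; rewrite ?mul0r ?mulr0 //.
  rewrite subn1 /= -pmulrn big_ord_recl subr0 factS natrM.
  have -> : \prod_(i < p) (a + 1 - (lift ord0 i)%:R) = \prod_(i < p) (a - i%:R).
    by apply: eq_bigr => i _; rewrite /= /bump /= natrD; ring.
  have p0 : p.+1%:R != 0 :> R[i] by rewrite pnatr_eq0.
  have f0 : p`!%:R != 0 :> R[i] by rewrite pnatr_eq0 -lt0n fact_gt0.
  by move: p.+1%:R p`!%:R p0 f0 => P F p0 f0; field; rewrite p0 f0.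
have yN' m : y <> m%:~R by move=> ym; apply: yN; exists m.
have yN1 m : y - 1 <> m%:~R.
  by move=> ym; apply: (yN' (m + 1)); rewrite rmorphD /= -ym subrK.
have y0 : y != 0 by apply/eqP; exact: (yN' 0).
rewrite !binomC_nonint // (GammaD1 a0) subrK (GammaD1 y0) !invfM.
rewrite (_ : a - (y - 1) + 1 = a + 1 - y + 1); last by ring.
by move: (Gamma y)^-1 (Gamma (a + 1 - y + 1))^-1 => P Q; field.
Qed.

(** First [b] steps of [binomC_diag] give the factors in [y - s], then [a] steps of [binomC_upper],
    starting from upper index [x + b], give the others. The hypothesis keeps every intermediate
    upper index plus 1 nonzero. *)
Lemma binomC_shift (R : realType) (x y : R[i]) (a b : nat) :
    (forall m : nat, x + m.+1%:R != 0) ->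
  binomC x (y - b%:R) * \prod_(m < a + b) (x + m.+1%:R) =
  binomC (x + (a + b)%:R) y *
    (\prod_(s < b) (y - s%:R) * \prod_(m < a) (x - y + b%:R + m.+1%:R)).
Proof.
elim: b x => [|b IHb] x xN.
  rewrite subr0 addn0 big_ord0 mul1r.
  elim: a x xN => [|a IHa] x xN; first by rewrite !big_ord0 addr0.
  have xN1 m : x + 1 + m.+1%:R != 0 by rewrite -addrA nat1r.
  rewrite !big_ord_recl mulrA binomC_upper ?(xN 0%N) //.
  rewrite mulrAC.
  have -> : \prod_(i < a) (x + (lift ord0 i).+1%:R) = \prod_(i < a) (x + 1 + i.+1%:R).
    by apply: eq_bigr => i _; rewrite -addrA nat1r.
  rewrite IHa // -(addrA x 1 a%:R) nat1r -mulrA; congr (_ * _); rewrite mulrC; congr (_ * _).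
    by rewrite /=; ring.
  by apply: eq_bigr => i _; rewrite /= /bump /= -[in RHS]nat1r; ring.
have xN1 m : x + 1 + m.+1%:R != 0 by rewrite -addrA nat1r.
rewrite addnS big_ord_recl mulrA -(natr1 b) opprD addrA binomC_diag ?(xN 0%N) //.
rewrite mulrAC.
have -> : \prod_(i < a + b) (x + (lift ord0 i).+1%:R) = \prod_(i < a + b) (x + 1 + i.+1%:R).
  by apply: eq_bigr => i _; rewrite -addrA nat1r.
rewrite IHb // -(addrA x 1 (a + b)%:R) nat1r -!mulrA; congr (_ * _).
rewrite big_ord_recr /= -mulrA; congr (_ * _); rewrite mulrC; congr (_ * _).
by apply: eq_bigr => i _; ring.
Qed.

(** * Vandermonde convolution with complex upper indices *)

Lemma binomC_natS (R : realType) (x : R[i]) (p : nat) :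
  p.+1%:R * binomC x p.+1%:R = (x - p%:R) * binomC x p%:R.
Proof.
rewrite !binomC_nat big_ord_recr factS natrM invfM /=.
have : p.+1%:R != 0 :> R[i] by rewrite pnatr_eq0.
by move: p.+1%:R (p`!%:R^-1) => P F P0; field.
Qed.

Lemma binomC_Vandermonde (R : realType) (x y : R[i]) (m : nat) :
  \sum_(s < m.+1) binomC x s%:R * binomC y (m - s)%:R = binomC (x + y) m%:R.
Proof.
elim: m => [|m IHm].
  by rewrite big_ord1 subnn !binomC_nat !big_ord0 fact0 divr1 mulr1.
have m0 : m.+1%:R != 0 :> R[i] by rewrite pnatr_eq0.
apply: (mulfI m0); rewrite binomC_natS -IHm !mulr_sumr.
(* The factor [m + 1] is split as [s + (m + 1 - s)]. Lowering one index in each part by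
   [binomC_natS] leaves the total weight [(x - s) + (y - (m - s)) = x + y - m]. *)
transitivity (\sum_(s < m.+2) s%:R * binomC x s%:R * binomC y (m.+1 - s)%:R +
    \sum_(s < m.+2) binomC x s%:R * ((m.+1 - s)%:R * binomC y (m.+1 - s)%:R)).
  rewrite -big_split /=; apply: eq_bigr => s _.
  by move: (binomC y _) => w; rewrite natrB -1?ltnS //; ring.
rewrite big_ord_recl !mul0r add0r [X in _ + X]big_ord_recr /= subnn !mul0r mulr0 addr0.
rewrite -big_split /=; apply: eq_bigr => s _.
rewrite /bump /= add1n subSS binomC_natS subSn ?binomC_natS; last by rewrite -ltnS.
by move: (binomC y _) => w; rewrite natrB -1?ltnS //; ring.
Qed.

Lemma binomC_opp (R : realType) (x : R[i]) (m : nat) :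
  binomC (x - 1 + m%:R) m%:R * (-1) ^+ m = binomC (- x) m%:R.
Proof.
rewrite !binomC_nat mulrAC; congr (_ / _); rewrite mulrC.
(* Read in reverse, the factors are [x, x + 1, ...]; negated, they are those of the falling product
   of [- x]. *)
rewrite (reindex_inj rev_ord_inj) /= -[in (-1) ^+ _](card_ord m) -prodrN.
apply: eq_bigr => k _; rewrite natrB // -natr1; ring.
Qed.

(** Terms with [k < i] vanish; for [i <= j] the rest is a Vandermonde convolution with value
    [binom(0, j - i)]. *)
Lemma sum_binomC_delta (R : realType) (x : R[i]) (i j : nat) :
  \sum_(k < j.+1) binomC x (k%:R - i%:R) * binomC (- x) (j - k)%:R = (i == j)%:R.
Proof.
have neg k : (k < i)%N -> binomC x (k%:R - i%:R) = 0.
  move=> ki; have -> : k%:R - i%:R = (Negz (i - k).-1)%:~R :> R[i].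
    by rewrite NegzE rmorphN prednK ?subn_gt0 //= -pmulrn natrB ?opprB // ltnW.
  by rewrite binomC_int.
have [ji|ij] := ltnP j i.
  rewrite gtn_eqF // big1 // => k _.
  by rewrite neg ?mul0r // (leq_trans (ltn_ord k)).
rewrite -(big_mkord xpredT (fun k => binomC x (k%:R - i%:R) * binomC (- x) (j - k)%:R)).
rewrite (big_cat_nat (n := i)) //=; last exact: leq_trans ij _.
rewrite big_nat big1 ?add0r => [|k /andP[_ ki]]; last by rewrite neg ?mul0r.
rewrite -{1}(add0n i) big_addn subSn // big_mkord.
under eq_bigr => k _ do rewrite natrD addrK addnC subnDA.
rewrite binomC_Vandermonde subrr binomC_nat.
have [->|nij] := eqVneq i j; first by rewrite subnn big_ord0 fact0 divr1.
have ij0 : (0 < j - i)%N by rewrite subn_gt0 ltn_neqAle nij.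
by rewrite -(prednK ij0) big_ord_recl subrr !mul0r.
Qed.

(** * Degree bound and Lagrange interpolation *)

Lemma size_prod_linear (F : idomainType) (I : finType) (P : pred I) (f : I -> {poly F}) :
  (forall i, P i -> (size (f i) <= 2)%N) -> (size (\prod_(i | P i) f i)%R <= #|P|.+1)%N.
Proof.
move=> fs; apply: leq_trans (size_prod_leq _ _) _.
rewrite leq_subLR addnS ltnS addnn -mul2n mulnC -sum_nat_const.
exact: leq_sum.
Qed.

(** The difference of [p] and its interpolant has size at most [n] and vanishes at [n] distinct
    nodes. *)
Lemma lagrange_interpolation (F : fieldType) (n : nat) (b : 'I_n -> F)
    (p : {poly F}) (x : F) : injective b -> (size p <= n)%N ->
  p.[x] = \sum_(l < n) p.[b l] * \prod_(m < n | m != l) ((x - b m) / (b l - b m)).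
Proof.
move=> b_inj sp.
pose L l : {poly F} := \prod_(m < n | m != l) ((b l - b m)^-1 *: ('X - (b m)%:P)).
have LE l y : (L l).[y] = \prod_(m < n | m != l) ((y - b m) / (b l - b m)).
  by rewrite horner_prod; apply: eq_bigr => m _; rewrite !hornerE mulrC.
pose q : {poly F} := \sum_(l < n) p.[b l] *: L l.
suff pq : p = q.
  by rewrite [in LHS]pq horner_sum; apply: eq_bigr => l _; rewrite hornerZ LE.
apply/eqP; rewrite -subr_eq0; apply/eqP.
apply: (@roots_geq_poly_eq0 _ _ [seq b l | l <- enum 'I_n]).
- apply/allP => _ /mapP[l _ ->]; rewrite rootE !hornerE horner_sum (bigD1 l) //=.
  rewrite hornerZ LE big1 => [|m ml]; last first.
    by rewrite divff // subr_eq0 (inj_eq b_inj) eq_sym.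
  rewrite mulr1 big1 => [|m ml]; first by rewrite addr0 subrr.
  by rewrite hornerZ LE (bigD1 l) 1?eq_sym //= subrr !mul0r mulr0.
- by rewrite map_inj_uniq ?enum_uniq.
rewrite size_map size_enum_ord; apply: leq_trans (size_polyD _ _) _.
rewrite size_polyN geq_max sp /=; apply: leq_trans (size_sum _ _ _) _.
apply/bigmax_leqP => l _; apply: leq_trans (size_scale_leq _ _) _.
apply: leq_trans (size_prod_linear _) _ => [m _|].
  by apply: leq_trans (size_scale_leq _ _) _; rewrite size_XsubC.
by rewrite cardC1 card_ord prednK // (leq_ltn_trans _ (ltn_ord l)).
Qed.

(** * The inverse matrix *)

Unset Implicit Arguments.

Theorem theorem1 (R : realType) (n : nat) (A : R[i]) (B : 'I_n -> R[i])
    (hn : (1 <= n)%N)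
    (hA : forall m : nat, A <> - m.+1%:R)
    (hB : injective B)
    (hAB : forall i : 'I_n, binomC (A + n%:R - 1) (B i - 1) <> 0) :
  let M : 'M[R[i]]_n :=
    \matrix_(i < n, j < n) binomC A (B j - i.+1%:R) in
  M \in unitmx /\
  forall i j : 'I_n,
    invmx M i j =
    (binomC (A + n%:R - 1) (B i - 1))^-1 *
    \sum_(1 <= k < j.+2)
      binomC (A + n%:R - 1) (k%:R - 1) *
      binomC (A - 1 + j.+1%:R - k%:R) (j.+1%:R - k%:R) *
      (-1) ^+ (k + j.+1) *
      \prod_(l < n | l != i) ((k%:R - B l) / (B i - B l)).
Proof.
move=> M.
have nB : n%:R - 1 = n.-1%:R :> R[i] by rewrite -{1}(prednK hn) -natr1 addrK.
have hA' m : A + m.+1%:R != 0 by rewrite addr_eq0; apply/eqP.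
pose P : R[i] := \prod_(m < n.-1) (A + m.+1%:R).
have P0 : P != 0 by apply/prodf_neq0 => m _; exact: hA'.
(* The ordinal [i] stands for row [i + 1]: there are [i] factors of the first kind and [n - 1 - i]
   of the second, as in [binomC_shift] at [y - 1]. *)
pose q (i : 'I_n) : {poly R[i]} := \prod_(s < i) ('X - (1 + s%:R)%:P) *
  \prod_(m < n.-1 - i) ((A + 1 + i%:R + m.+1%:R)%:P - 'X).
have in1 (i : 'I_n) : (n.-1 - i + i = n.-1)%N by rewrite subnK // -ltnS prednK.
have sq i : (size (q i) <= n)%N.
  have s1 : (size (\prod_(s < i) ('X - (1 + s%:R)%:P) : {poly R[i]})%R <= i.+1)%N.
    rewrite -[X in (_ <= X.+1)%N]card_ord.
    by apply: size_prod_linear => s _; rewrite size_XsubC.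
  have s2 : (size (\prod_(m < n.-1 - i) ((A + 1 + i%:R + m.+1%:R)%:P - 'X) : {poly R[i]})%R
      <= (n.-1 - i).+1)%N.
    rewrite -[X in (_ <= X.+1)%N]card_ord.
    by apply: size_prod_linear => s _; rewrite -opprB size_polyN size_XsubC.
  apply: leq_trans (size_polyMleq _ _) _.
  by rewrite -subn1 leq_subLR (leq_trans (leq_add s1 s2)) // addSn addnS addnC in1 prednK.
have qE (i : 'I_n) y : binomC A (y - i.+1%:R) * P =
    binomC (A + n%:R - 1) (y - 1) * (q i).[y].
  rewrite -nat1r opprD addrA /P -[in \prod_(_ < _) _](in1 i) binomC_shift //.
  rewrite in1 -(addrA A n%:R) nB; congr (_ * _).
  rewrite hornerM !horner_prod; congr (_ * _).
    by apply: eq_bigr => s _; rewrite !hornerE; ring.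
  by apply: eq_bigr => s _; rewrite !hornerE; ring.
pose N : 'M[R[i]]_n := \matrix_(i < n, j < n)
  ((binomC (A + n%:R - 1) (B i - 1))^-1 *
   \sum_(1 <= k < j.+2)
     binomC (A + n%:R - 1) (k%:R - 1) *
     binomC (A - 1 + j.+1%:R - k%:R) (j.+1%:R - k%:R) *
     (-1) ^+ (k + j.+1) *
     \prod_(l < n | l != i) ((k%:R - B l) / (B i - B l))).
suff MN : M *m N = 1%:M.
  have [Mu _] := mulmx1_unit MN; split=> // i j.
  by rewrite -[invmx M]mulmx1 -MN mulKmx // mxE.
apply/matrixP => i j; rewrite !mxE -[RHS](sum_binomC_delta A i j).
pose c k : R[i] := binomC (A + n%:R - 1) (k%:R - 1) *
  binomC (A - 1 + j.+1%:R - k%:R) (j.+1%:R - k%:R) * (-1) ^+ (k + j.+1).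
transitivity (P^-1 * \sum_(1 <= k < j.+2) c k * (q i).[k%:R]).
  (* By [qE] the column factor of [M] cancels the inverse binomial in row [l] of [N]; this is where
     [hAB] enters. *)
  transitivity (\sum_(l < n) \sum_(1 <= k < j.+2) P^-1 * (c k * ((q i).[B l] *
      \prod_(m < n | m != l) ((k%:R - B m) / (B l - B m))))).
    apply: eq_bigr => l _; rewrite !mxE -[binomC A _](mulfK P0) qE.
    rewrite !mulr_sumr; apply: eq_bigr => k _; rewrite /c.
    have := hAB l; move/eqP; move: (binomC _ (B l - 1)) => b b0.
    by field; rewrite b0 P0.
  rewrite exchange_big mulr_sumr; apply: eq_bigr => k _.
  by rewrite -!mulr_sumr -lagrange_interpolation.
rewrite mulr_sumr big_add1 big_mkord /=; apply: eq_bigr => k _.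
have kj : (k <= j)%N by rewrite -ltnS.
have := qE i k.+1%:R; rewrite /c.
have -> : k.+1%:R - i.+1%:R = k%:R - i%:R :> R[i] by rewrite -!natr1; ring.
(* [h] is [qE] at the node [k + 1], used to turn [binom(A, k - i)] back into a value of [q i];
   [binomC_opp] accounts for the second binomial and the sign. *)
move=> h; rewrite -binomC_opp -[binomC A _](mulfK P0) h.
have -> : j.+1%:R - k.+1%:R = (j - k)%:R :> R[i] by rewrite natrB // -!natr1; ring.
have -> : A - 1 + j.+1%:R - k.+1%:R = A - 1 + (j - k)%:R.
  by rewrite natrB // -!natr1; ring.
have -> : (-1) ^+ (k.+1 + j.+1) = (-1) ^+ (j - k) :> R[i].
  by rewrite -signr_odd -[RHS]signr_odd oddD oddB //= addbN addNb negbK addbC.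
by move: (binomC _ (j - k)%:R) (_ ^+ _) => u v; field.
Qed.
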